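(* Let $\alpha\ge 0$ and $\gamma\ge 1$ be real numbers and let $\beta\in\mathbb{C}$ satisfy $\gamma+\alpha\ge |\beta|$. Then for every integer $m\ge 0$ and every $z\in\mathfrak{U}$, $$\operatorname{Re}\left\{\frac{\mathbb{I}[\mathbb{R}_{\alpha,\beta,\gamma}](z)}{(\mathbb{I}[\mathbb{R}_{\alpha,\beta,\gamma}])_m(z)}\right\}\ge \frac{2(\gamma+\alpha)-2|\beta|}{2(\gamma+\alpha)-|\beta|}$$ and $$\operatorname{Re}\left\{\frac{(\mathbb{I}[\mathbb{R}_{\alpha,\beta,\gamma}])_m(z)}{\mathbb{I}[\mathbb{R}_{\alpha,\beta,\gamma}](z)}\right\}\ge \frac{2(\gamma+\alpha)-|\beta|}{2(\gamma+\alpha)},$$ where $\mathbb{I}[\mathbb{R}_{\alpha,\beta,\gamma}]$ is the Alexander transform of $\mathbb{R}_{\alpha,\beta,\gamma}$.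
   Context: $\mathfrak{U}=\{z\in\mathbb{C}:|z|<1\}$ is the open unit disc. For real $\alpha\ge 0$, $\gamma\ge 1$ and $\beta\in\mathbb{C}$, the normalized (generalized) Rabotnov function is $$\mathbb{R}_{\alpha,\beta,\gamma}(z)=z+\sum_{n=1}^{\infty}A_n z^{n+1},\qquad A_n=\frac{\beta^n\,\Gamma(\gamma+\alpha)}{\Gamma((\gamma+\alpha)(n+1))},\qquad z\in\mathfrak{U},$$ where $\Gamma$ is the Gamma function. The Alexander transform of an analytic function $f(z)=z+\sum_{n=2}^\infty a_n z^n$ on $\mathfrak{U}$ is $\mathbb{I}[f](z)=\int_0^z \frac{f(t)}{t}\,dt=z+\sum_{n=2}^{\infty}\frac{a_n}{n}z^n$. Thus $\mathbb{I}[\mathbb{R}_{\alpha,\beta,\gamma}](z)=z+\sum_{n=1}^{\infty}\frac{A_n}{n+1}z^{n+1}$, and its partial sums are $(\mathbb{I}[\mathbb{R}_{\alpha,\beta,\gamma}])_m(z)=z+\sum_{n=1}^{m}\frac{A_n}{n+1}z^{n+1}$ for $m\in\{1,2,3,\dots\}$ and $(\mathbb{I}[\mathbb{R}_{\alpha,\beta,\gamma}])_0(z)=z$. At $z=0$ the quotients are understood by removing the common factor $z$ from numerator and denominator (removable singularity). *)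

(* Defs.v *)
(* Stdlib reals with Coquelicot. *)
From Stdlib Require Import Reals.
From Coquelicot Require Import Coquelicot.
Local Open Scope R_scope.

(* Euler's integral; meaningful for x > 0. *)
Definition Gamma (x : R) : R :=
  RInt_gen (fun t => Rpower t (x - 1) * exp (- t))
    (at_right 0) (Rbar_locally p_infty).

(* Sum of a complex series, total in the same way as Coquelicot's RInt. *)
Definition CSeries (a : nat -> C) : C :=
  @iota C_CompleteNormedModule (@is_series C_AbsRing C_NormedModule a).

Definition rabotnov_coef (alpha gamma : R) (beta : C) (n : nat) : C :=
  (beta ^ n * RtoC (Gamma (gamma + alpha))
     / RtoC (Gamma ((gamma + alpha) * INR (n + 1))))%C.

(* CSeries starts at index 0, hence the shift n -> S n. *)
Definition rabotnov (alpha gamma : R) (beta : C) (z : C) : C :=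
  (z + CSeries (fun n => rabotnov_coef alpha gamma beta (S n) * z ^ (S n + 1)))%C.

(* Integral of f(w)/w dw along the segment w = t z, 0 <= t <= 1. The integrand
   is assigned the value of Coquelicot's x / 0 at t = 0, which does not affect
   the Riemann integral. *)
Definition alexander (f : C -> C) (z : C) : C :=
  @RInt C_R_CompleteNormedModule
    (fun t : R => (f (RtoC t * z) / (RtoC t * z) * z)%C) 0 1.

(* sum_n_m over 1 .. m is empty when m = 0. *)
Definition alexander_rabotnov_partial (alpha gamma : R) (beta : C) (m : nat)
    (z : C) : C :=
  (z + @sum_n_m C_AbelianMonoid
         (fun n => rabotnov_coef alpha gamma beta n / RtoC (INR (n + 1))
                   * z ^ (n + 1)) 1 m)%C.

(* q is the value at z of f / g, the singularity at 0 being removed. Division in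
   C is total, so that the denominator is required not to vanish. *)
Definition is_quotient (f g : C -> C) (z q : C) : Prop :=
  (z <> RtoC 0 /\ g z <> RtoC 0 /\ q = (f z / g z)%C)
  \/ (z = RtoC 0
      /\ @locally' C_UniformSpace z (fun w => g w <> RtoC 0)
      /\ filterlim (fun w => (f w / g w)%C)
           (@locally' C_UniformSpace z) (@locally C_UniformSpace q)).

(* Main.v *)
(* Write s = gamma + alpha >= 1 and x = |beta| / s <= 1, and let a_n be the coefficient of
   z^(n+1) in the transform. Gamma (y + s) >= y * Gamma y for y >= 1 gives
   Gamma (s (n + 1)) >= s^n n! Gamma s, hence |a_n| <= x^n / (n+1)! <= (x/2)^n.
   Divide the transform and its partial sum by z, and call the results p and q.
   With e = x |z| / 2 and r = e / (1 - e) < 1, the geometric bound gives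
   |q - 1| <= h and |p - q| <= r - h for some h, hence |p/q - 1| <= (r - h) / (1 - h) <= r.
   So Re (p/q) >= 1 - r and Re (q/p) >= 1 / (1 + r), and r <= |beta| / (2 s - |beta|). *)
Require Import Defs.
From Stdlib Require Import Reals Lra Lia Factorial.
From Coquelicot Require Import Coquelicot.
Local Open Scope R_scope.

(** * The Gamma function *)

(** Integrals of a nonnegative function grow with the interval, so bounded ones converge to their
    supremum [l]. The second conclusion records that [l] dominates every proper integral, which
    later gives positivity of [Gamma]. *)
Lemma is_RInt_gen_bounded_nonneg (f : R -> R) (M : R) :
  (forall t, 0 < t -> 0 <= f t) ->
  (forall t, 0 < t -> continuous f t) ->
  (forall a b, 0 < a -> a <= b -> RInt f a b <= M) ->
  exists l, is_RInt_gen f (at_right 0) (Rbar_locally p_infty) l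
    /\ (forall a b, 0 < a -> a <= b -> RInt f a b <= l).
Proof.
intros Hpos Hcont HM.
assert (Hex : forall a b, 0 < a -> 0 < b -> ex_RInt f a b).
{ intros a b Ha Hb. apply (ex_RInt_continuous (V := R_CompleteNormedModule)).
  intros t Ht. apply Hcont. apply Rlt_le_trans with (2 := proj1 Ht).
  now apply Rmin_glb_lt. }
destruct (completeness (fun v => exists a b, 0 < a /\ a <= b /\ v = RInt f a b))
  as [l [Hub Hlub]].
{ exists M. intros v (a & b & Ha & Hab & ->). now apply HM. }
{ exists (RInt f 1 1), 1, 1. repeat split; lra. }
assert (Hle : forall a b, 0 < a -> a <= b -> RInt f a b <= l).
{ intros a b Ha Hab. apply Hub. now exists a, b. }
exists l. split; [|exact Hle].
intros P [eps HP].
assert (Hnear : exists a b, 0 < a /\ a <= b /\ l - eps < RInt f a b).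
{ apply Classical_Prop.NNPP. intros Hno.
  assert (H : l <= l - eps).
  { apply Hlub. intros v (a & b & Ha & Hab & ->).
    apply Rnot_lt_le. intros Hlt. apply Hno. now exists a, b. }
  destruct eps as [e He]; simpl in H; lra. }
destruct Hnear as (a0 & b0 & Ha0 & Hab0 & Hclose).
(* Any such [a], [b] give an interval containing [[a0, b0]], whose integral is already within [eps]
   of the supremum. *)
exists (fun a => 0 < a < a0) (fun b => b0 < b).
- exists (mkposreal a0 Ha0). intros a Hball Ha.
  unfold ball in Hball; simpl in Hball; unfold AbsRing_ball in Hball; simpl in Hball.
  unfold abs, minus, plus, opp in Hball; simpl in Hball.
  apply Rabs_def2 in Hball. lra.
- exists b0. auto.
- intros a b [Ha Haa0] Hb. simpl. exists (RInt f a b). split.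
  { apply (RInt_correct f). apply Hex; lra. }
  apply HP. unfold ball; simpl; unfold AbsRing_ball; simpl.
  unfold abs, minus, plus, opp; simpl.
  assert (Hsplit : RInt f a b = RInt f a a0 + (RInt f a0 b0 + RInt f b0 b)).
  { rewrite <- (RInt_Chasles f a a0 b) by (apply Hex; lra).
    rewrite <- (RInt_Chasles f a0 b0 b) by (apply Hex; lra). reflexivity. }
  assert (0 <= RInt f a a0).
  { apply RInt_ge_0; [lra| apply Hex; lra | intros; apply Hpos; lra]. }
  assert (0 <= RInt f b0 b).
  { apply RInt_ge_0; [lra| apply Hex; lra | intros; apply Hpos; lra]. }
  assert (RInt f a b <= l) by (apply Hle; lra).
  apply Rabs_def1; destruct eps as [e He]; simpl in *; lra.
Qed.

Lemma is_lim_seq_inv_INR_S : is_lim_seq (fun n => / INR (S n)) 0.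
Proof.
apply (is_lim_seq_incr_1 (fun n => / INR n)).
apply (is_lim_seq_inv _ p_infty); [apply is_lim_seq_INR | discriminate].
Qed.

Lemma is_lim_seq_le_inv_INR (u : nat -> R) (K : R) :
  (forall n, Rabs (u n) <= K * / INR (S n)) -> is_lim_seq u 0.
Proof.
intros Hu. apply is_lim_seq_abs_0.
apply (is_lim_seq_le_le (fun _ => 0) _ (fun n => K * / INR (S n))).
- intros n. split; [apply Rabs_pos|apply Hu].
- apply is_lim_seq_const.
- replace (Finite 0) with (Finite (K * 0)) by (f_equal; ring).
  apply (is_lim_seq_scal_l _ K 0), is_lim_seq_inv_INR_S.
Qed.

(** Replaces the limit along two filters by a limit over the intervals [[1/(n+1), n+1]], so that
    comparison of sequences applies. *)
Lemma is_lim_seq_RInt_gen (f : R -> R) (l : R) :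
  is_RInt_gen f (at_right 0) (Rbar_locally p_infty) l ->
  is_lim_seq (fun n => RInt f (/ INR (S n)) (INR (S n))) l.
Proof.
intros Hl P HP. destruct (Hl P HP) as [Q Q' [d HQ] [B HQ'] HQQ'].
pose proof is_lim_seq_inv_INR_S as Hinv.
assert (Hinf : is_lim_seq (fun n => INR (S n)) p_infty).
{ apply -> (is_lim_seq_incr_1 INR). apply is_lim_seq_INR. }
assert (H1 : eventually (fun n => ball 0 d (/ INR (S n)))).
{ apply Hinv. exists d. auto. }
assert (H2 : eventually (fun n => B < INR (S n))).
{ apply Hinf. exists B. auto. }
unfold filtermap. generalize (filter_and _ _ H1 H2). apply filter_imp. intros n [Hn1 Hn2].
assert (Hn : 0 < / INR (S n)) by (apply Rinv_0_lt_compat, lt_0_INR; lia).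
destruct (HQQ' _ _ (HQ _ Hn1 Hn) (HQ' _ Hn2)) as (v & Hv & HPv). unfold fst, snd in Hv.
now rewrite (is_RInt_unique _ _ _ _ Hv).
Qed.

Lemma exp_le_compat (x y : R) : x <= y -> exp x <= exp y.
Proof.
intros [H| ->]; [left; now apply exp_increasing|right; reflexivity].
Qed.

Lemma ln_le_minus_one (t : R) : 0 < t -> ln t <= t - 1.
Proof.
intros Ht. rewrite <- (ln_exp (t - 1)). apply ln_le; [easy|].
generalize (exp_ineq1_le (t - 1)). lra.
Qed.

Lemma continuous_gamma_integrand (x t : R) :
  0 < t -> continuous (fun t => Rpower t x * exp (- t)) t.
Proof.
intros Ht. apply (ex_derive_continuous (V := R_NormedModule)).
unfold Rpower. now auto_derive.
Qed.

(** The tangent of [ln] at [q = 2 p + 1] lies above [ln] and has slope [1/q]. Since [p / q <= 1/2],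
    [p ln t] is at most [t / 2] plus the constant [p ln q]. *)
Lemma Rpower_exp_decay (p : R) :
  0 <= p -> exists C, 0 < C /\
    forall t, 0 < t -> Rpower t p * exp (- t) <= C * exp (- (t / 2)).
Proof.
intros Hp. exists (exp (p * ln (2 * p + 1))). split; [apply exp_pos|].
intros t Ht. unfold Rpower. rewrite <- !exp_plus. apply exp_le_compat.
set (q := 2 * p + 1).
assert (Hq : 0 < q) by (unfold q; lra).
assert (Hln : ln t <= t / q - 1 + ln q).
{ replace t with (t / q * q) at 1 by (field; lra).
  assert (0 < t / q) by now apply Rdiv_lt_0_compat.
  rewrite ln_mult by easy. generalize (ln_le_minus_one _ H). lra. }
assert (p * ln t <= p * (t / q - 1 + ln q)) by now apply Rmult_le_compat_l.
assert (p * (t / q) <= t / 2).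
{ replace (t / 2) with (q / 2 * (t / q)) by (field; lra).
  apply Rmult_le_compat_r; [|unfold q; lra].
  left; now apply Rdiv_lt_0_compat. }
lra.
Qed.

(** [RInt_gen] is total, so convergence must be established before [Gamma x] can be used as an
    integral. The integrand is dominated by [C exp (- t / 2)], whose integral over any [[a, b]] with
    [0 < a] is at most [2 C]. *)
Lemma Gamma_correct (x : R) : 1 <= x ->
  is_RInt_gen (fun t => Rpower t (x - 1) * exp (- t))
    (at_right 0) (Rbar_locally p_infty) (Gamma x)
  /\ 0 < Gamma x.
Proof.
intros Hx.
set (f := fun t => Rpower t (x - 1) * exp (- t)).
assert (Hpos : forall t, 0 < f t).
{ intros t. apply Rmult_lt_0_compat; apply exp_pos. }
assert (Hcont : forall t, 0 < t -> continuous f t).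
{ intros t. apply continuous_gamma_integrand. }
assert (Hex : forall a b, 0 < a -> a <= b -> ex_RInt f a b).
{ intros a b Ha Hab. apply (ex_RInt_continuous (V := R_CompleteNormedModule)).
  intros t Ht. apply Hcont. rewrite Rmin_left in Ht; lra. }
destruct (Rpower_exp_decay (x - 1)) as (C & HC & Hdecay); [lra|].
destruct (is_RInt_gen_bounded_nonneg f (2 * C)) as (l & Hl & Hle).
- intros t _. now apply Rlt_le.
- exact Hcont.
- intros a b Ha Hab.
  assert (HI : is_RInt (fun t => C * exp (- (t / 2))) a b
    (minus (- 2 * C * exp (- (b / 2))) (- 2 * C * exp (- (a / 2))))).
  { apply (is_RInt_derive (fun t => - 2 * C * exp (- (t / 2)))).
    - intros t _. auto_derive; [easy|]. unfold Rdiv; field.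
    - intros t _. apply (ex_derive_continuous (V := R_NormedModule)).
      now auto_derive. }
  apply Rle_trans with (RInt (fun t => C * exp (- (t / 2))) a b).
  { apply RInt_le; [easy|now apply Hex|eexists; exact HI|].
    intros t Ht. apply Hdecay. lra. }
  rewrite (is_RInt_unique _ _ _ _ HI). unfold minus, plus, opp; simpl.
  assert (0 < C * exp (- (b / 2))) by (apply Rmult_lt_0_compat; [easy|apply exp_pos]).
  assert (C * exp (- (a / 2)) <= C * 1).
  { apply Rmult_le_compat_l; [lra|]. rewrite <- exp_0. apply exp_le_compat. lra. }
  lra.
- assert (HG : Gamma x = l).
  { unfold Gamma. exact (is_RInt_gen_unique (V := R_CompleteNormedModule)
      (FFa := Proper_StrongProper _ (at_right_proper_filter 0))
      (FFb := Proper_StrongProper _ (Rbar_locally_filter p_infty)) f l Hl). }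
  rewrite HG. split; [exact Hl|].
  apply Rlt_le_trans with (RInt f 1 2); [|apply Hle; lra].
  apply RInt_gt_0; [lra|easy|]. intros t Ht. apply Hcont. lra.
Qed.

Lemma Gamma_lim (x : R) : 1 <= x ->
  is_lim_seq (fun n => RInt (fun t => Rpower t (x - 1) * exp (- t))
    (/ INR (S n)) (INR (S n))) (Gamma x).
Proof. intros Hx. apply is_lim_seq_RInt_gen, Gamma_correct, Hx. Qed.

(** The chain is [t^y (t^d - 1) >= d t^y ln t >= d t ln t >= d (t - 1)]; each link rests on
    [ln u <= u - 1] or on [y >= 1]. *)
Lemma Rpower_diff_ge (y d t : R) : 1 <= y -> 0 <= d -> 0 < t ->
  d * (t - 1) <= Rpower t (y + d) - Rpower t y.
Proof.
intros Hy Hd Ht.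
assert (Hlnlow : t - 1 <= t * ln t).
{ assert (Hi : 0 < / t) by now apply Rinv_0_lt_compat.
  generalize (ln_le_minus_one _ Hi). rewrite ln_Rinv by easy. intros H.
  apply (Rmult_le_compat_l t) in H; [|lra].
  replace (t * (/ t - 1)) with (1 - t) in H by (field; lra). lra. }
assert (Hy1 : t * ln t <= Rpower t y * ln t).
{ replace (Rpower t y) with (t * Rpower t (y - 1)).
  2:{ rewrite <- (Rpower_1 t Ht) at 1. rewrite <- Rpower_plus. f_equal. ring. }
  (* [ln t] and [t^(y-1) - 1] change sign together at [t = 1]. *)
  destruct (Rle_or_lt 1 t) as [H1|H1].
  - assert (0 <= ln t) by (rewrite <- ln_1; apply ln_le; lra).
    assert (1 <= Rpower t (y - 1)).
    { rewrite <- (Rpower_O t Ht) at 1. apply Rle_Rpower; lra. }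
    apply Rmult_le_compat_r; [easy|].
    rewrite <- (Rmult_1_r t) at 1. apply Rmult_le_compat_l; lra.
  - assert (ln t < 0) by (rewrite <- ln_1; apply ln_increasing; lra).
    assert (Rpower t (y - 1) <= 1).
    { unfold Rpower. rewrite <- exp_0 at 2. apply exp_le_compat. nra. }
    assert (t * Rpower t (y - 1) <= t * 1) by (apply Rmult_le_compat_l; lra). nra. }
assert (Hd1 : d * ln t <= Rpower t d - 1).
{ generalize (ln_le_minus_one (Rpower t d) (exp_pos _)).
  unfold Rpower at 1. now rewrite ln_exp. }
rewrite Rpower_plus.
assert (0 < Rpower t y) by apply exp_pos.
apply Rle_trans with (Rpower t y * (d * ln t)); [|nra].
apply Rle_trans with (d * (t * ln t)); nra.
Qed.

(** The preceding bound with [d = s - 1] gives [t^(y+s-1) >= t^y + (s - 1) (t - 1)]. Against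
    [exp (- t)] on the half-line, [t^y] integrates to [y * Gamma y] by parts and [t - 1] integrates
    to 0. *)
Lemma Gamma_add_ge (y s : R) : 1 <= y -> 1 <= s -> y * Gamma y <= Gamma (y + s).
Proof.
intros Hy Hs.
(* [F] is a primitive of a lower bound of the difference of the two integrands
   and vanishes at both ends. *)
set (F := fun t => - (s - 1) * (t * exp (- t)) - Rpower t y * exp (- t)).
set (dF := fun t => (s - 1) * (t - 1) * exp (- t)
    + Rpower t y * exp (- t) - y * (Rpower t (y - 1) * exp (- t))).
assert (HF : forall a b, 0 < a -> a <= b -> is_RInt dF a b (F b - F a)).
{ intros a b Ha Hab. apply (is_RInt_derive F dF).
  - intros t Ht. rewrite Rmin_left in Ht by easy.
    assert (H0 : 0 < t) by lra.
    assert (Hpw : Rpower t (y - 1) = Rpower t y / t).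
    { unfold Rminus. rewrite Rpower_plus, Rpower_Ropp, Rpower_1 by easy.
      reflexivity. }
    unfold F, dF. rewrite Hpw. unfold Rpower.
    auto_derive; [easy|]. field. lra.
  - intros t Ht. rewrite Rmin_left in Ht by easy.
    assert (H0 : 0 < t) by lra.
    apply (ex_derive_continuous (V := R_NormedModule)).
    unfold dF, Rpower. now auto_derive. }
destruct (Rpower_exp_decay y) as (C & HC & Hdecay); [lra|].
destruct (Rpower_exp_decay 1) as (C' & HC' & Hdecay'); [lra|].
apply (is_lim_seq_le
  (fun n => y * RInt (fun t => Rpower t (y - 1) * exp (- t)) (/ INR (S n)) (INR (S n))
     + (F (INR (S n)) - F (/ INR (S n))))
  (fun n => RInt (fun t => Rpower t (y + s - 1) * exp (- t)) (/ INR (S n)) (INR (S n)))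
  (y * Gamma y) (Gamma (y + s))).
- intros n.
  assert (Hn : 1 <= INR (S n)) by (rewrite S_INR; generalize (pos_INR n); lra).
  set (b := INR (S n)) in *.
  assert (Ha : 0 < / b) by (apply Rinv_0_lt_compat; lra).
  assert (Hab : / b <= b).
  { apply Rle_trans with 1; [|easy]. rewrite <- Rinv_1. apply Rinv_le_contravar; lra. }
  assert (Hex : forall p, ex_RInt (fun t => Rpower t p * exp (- t)) (/ b) b).
  { intros p. apply (ex_RInt_continuous (V := R_CompleteNormedModule)).
    intros t Ht. apply continuous_gamma_integrand.
    rewrite Rmin_left in Ht by easy. lra. }
  specialize (HF _ _ Ha Hab).
  assert (Hsum : is_RInt (fun t => plus (scal y (Rpower t (y - 1) * exp (- t))) (dF t)) (/ b) b
     (y * RInt (fun t => Rpower t (y - 1) * exp (- t)) (/ b) b + (F b - F (/ b)))).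
  { apply (is_RInt_plus (V := R_NormedModule)); [|exact HF].
    apply (is_RInt_scal (V := R_NormedModule)). apply (RInt_correct (V := R_CompleteNormedModule)), Hex. }
  rewrite <- (is_RInt_unique _ _ _ _ Hsum).
  apply RInt_le; [easy|eexists; exact Hsum|apply Hex|].
  intros t Ht. unfold plus, scal; simpl; unfold mult; simpl. unfold dF.
  assert (H0 : 0 < t) by lra.
  generalize (Rpower_diff_ge y (s - 1) t Hy). intros H.
  replace (y + (s - 1)) with (y + s - 1) in H by ring.
  assert (He : 0 < exp (- t)) by apply exp_pos.
  assert (Hd : 0 <= s - 1) by lra.
  specialize (H Hd H0). nra.
- replace (Finite (y * Gamma y)) with (Finite (y * Gamma y + (0 - 0))) by (f_equal; ring).
  apply is_lim_seq_plus'.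
  { apply (is_lim_seq_scal_l _ y (Gamma y)). now apply Gamma_lim. }
  apply is_lim_seq_minus'.
  (* At the upper end [b], the two terms of [F] are bounded by multiples of [exp (- b / 2)], which
     is at most [2 / b]. *)
  + apply is_lim_seq_le_inv_INR with (2 * ((s - 1) * C' + C)). intros n.
    assert (Hn : 0 < INR (S n)) by (apply lt_0_INR; lia).
    set (b := INR (S n)) in *.
    assert (Hb : exp (- (b / 2)) <= 2 * / b).
    { rewrite exp_Ropp. replace (2 * / b) with (/ (b / 2)) by (field; lra).
      apply Rinv_le_contravar; [lra|]. generalize (exp_ineq1_le (b / 2)). lra. }
    specialize (Hdecay b Hn). specialize (Hdecay' b Hn).
    rewrite Rpower_1 in Hdecay' by easy.
    assert (0 < Rpower b y * exp (- b)) by (apply Rmult_lt_0_compat; apply exp_pos).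
    assert (0 < b * exp (- b)) by (apply Rmult_lt_0_compat; [easy|apply exp_pos]).
    assert (C * exp (- (b / 2)) <= C * (2 * / b)) by (apply Rmult_le_compat_l; lra).
    assert (C' * exp (- (b / 2)) <= C' * (2 * / b)) by (apply Rmult_le_compat_l; lra).
    assert ((s - 1) * (b * exp (- b)) <= (s - 1) * (C' * (2 * / b)))
      by (apply Rmult_le_compat_l; lra).
    assert (0 <= (s - 1) * (b * exp (- b))) by (apply Rmult_le_pos; lra).
    unfold F. rewrite Rabs_left1; lra.
  (* At the lower end [a <= 1], [a^y <= a], so [F a] has absolute value at most
     [(s - 1) a + a = s a]. *)
  + apply is_lim_seq_le_inv_INR with s. intros n.
    assert (Hn : 1 <= INR (S n)) by (rewrite S_INR; generalize (pos_INR n); lra).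
    assert (Ha : 0 < / INR (S n)) by (apply Rinv_0_lt_compat; lra).
    assert (Ha1 : / INR (S n) <= 1) by (rewrite <- Rinv_1; apply Rinv_le_contravar; lra).
    set (a := / INR (S n)) in *.
    assert (He : exp (- a) <= 1) by (rewrite <- exp_0; apply exp_le_compat; lra).
    assert (He0 : 0 < exp (- a)) by apply exp_pos.
    assert (Hp : Rpower a y <= a).
    { rewrite <- (Rpower_1 a Ha) at 2. unfold Rpower. apply exp_le_compat.
      assert (ln a <= 0) by (rewrite <- ln_1; apply ln_le; lra). nra. }
    assert (Hp0 : 0 < Rpower a y) by apply exp_pos.
    assert (0 <= a * exp (- a) <= a) by nra.
    assert (0 <= Rpower a y * exp (- a) <= a) by nra.
    assert (0 <= (s - 1) * (a * exp (- a)) <= (s - 1) * a).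
    { split; [apply Rmult_le_pos|apply Rmult_le_compat_l]; lra. }
    unfold F. rewrite Rabs_left1; lra.
- apply Gamma_lim. lra.
Qed.

(** Induction on [n]: the previous inequality at [y = s (n + 1)] contributes the factor
    [s (n + 1)]. *)
Lemma Gamma_multiples_ge (s : R) (n : nat) : 1 <= s ->
  s ^ n * INR (fact n) * Gamma s <= Gamma (s * INR (n + 1)).
Proof.
intros Hs. induction n as [|n IH].
- simpl. rewrite !Rmult_1_r, Rmult_1_l. apply Rle_refl.
- replace (s * INR (S n + 1)) with (s * INR (n + 1) + s)
    by (rewrite (plus_INR (S n)), S_INR, plus_INR; simpl; ring).
  assert (Hn : 1 <= INR (n + 1)) by (rewrite plus_INR; generalize (pos_INR n); simpl; lra).
  assert (Hy : 1 <= s * INR (n + 1)) by nra.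
  apply Rle_trans with (2 := Gamma_add_ge _ _ Hy Hs).
  apply (Rmult_le_compat_l (s * INR (n + 1))) in IH; [|lra].
  apply Rle_trans with (2 := IH). apply Req_le.
  rewrite fact_simpl, mult_INR. replace (n + 1)%nat with (S n) by lia. simpl pow. ring.
Qed.

Lemma Cmod_rabotnov_coef_le (alpha gamma : R) (beta : C) (n : nat) :
  1 <= gamma + alpha ->
  Cmod (rabotnov_coef alpha gamma beta n)
    <= (Cmod beta / (gamma + alpha)) ^ n / INR (fact n).
Proof.
intros Hs. unfold rabotnov_coef. set (s := gamma + alpha) in *.
assert (HG : 0 < Gamma s) by now apply Gamma_correct.
generalize (Gamma_multiples_ge s n Hs). intros Hge.
assert (Hf : 0 < INR (fact n)) by apply INR_fact_lt_0.
assert (Hsn : 0 < s ^ n) by (apply pow_lt; lra).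
assert (Hl : 0 < s ^ n * INR (fact n) * Gamma s)
  by (apply Rmult_lt_0_compat; [apply Rmult_lt_0_compat|]; easy).
rewrite Cmod_div, Cmod_mult, Cmod_pow, !Cmod_R, !Rabs_pos_eq.
2,3: lra.
2:{ intros H. apply RtoC_inj in H. lra. }
replace ((Cmod beta / s) ^ n) with (Cmod beta ^ n * / s ^ n)
  by (unfold Rdiv; now rewrite Rpow_mult_distr, pow_inv).
apply Rle_trans with (Cmod beta ^ n * Gamma s / (s ^ n * INR (fact n) * Gamma s)).
- apply Rmult_le_compat_l.
  + apply Rmult_le_pos; [apply pow_le, Cmod_ge_0|lra].
  + apply Rinv_le_contravar; lra.
- apply Req_le. field. lra.
Qed.

(** * Complex series *)

Notation is_Cseries := (@is_series C_AbsRing C_NormedModule).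
Notation Csum_n := (@sum_n C_AbelianMonoid).

Lemma is_Cseries_approx (a : nat -> C) (l : C) (eps : R) (m : nat) :
  is_Cseries a l -> 0 < eps ->
  exists N, (m <= N)%nat /\ Cmod (Csum_n a N - l) < eps.
Proof.
intros Ha He.
destruct (proj1 (filterlim_locally_ball_norm (K := C_AbsRing) (U := C_NormedModule)
  (sum_n a) l) Ha (mkposreal eps He)) as [N HN].
exists (Nat.max m N). split; [lia|]. apply (HN (Nat.max m N)). lia.
Qed.

Lemma CSeries_unique (a : nat -> C) (l : C) : is_Cseries a l -> CSeries a = l.
Proof.
intros Ha. apply (iota_unique (V := C_CompleteNormedModule)); [|exact Ha].
intros y Hy.
exact (filterlim_locally_unique (K := C_AbsRing) (V := C_NormedModule) (F := eventually) (sum_n a) y l Hy Ha).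
Qed.

Lemma is_series_Re (a : nat -> C) (l : C) :
  is_Cseries a l -> is_series (fun n => Re (a n)) (Re l).
Proof.
intros Ha.
apply filterlim_ext with (fun n => Re (Csum_n a n)).
{ intros n. induction n as [|n IH]; [now rewrite !sum_O|].
  rewrite !sum_Sn, <- IH. reflexivity. }
(* [Re] is the first projection of the product [R * R], hence continuous. *)
apply filterlim_comp with (2 := continuous_fst (U := R_UniformSpace) (V := R_UniformSpace) (fst l) (snd l)).
destruct l. exact Ha.
Qed.

Lemma is_series_Im (a : nat -> C) (l : C) :
  is_Cseries a l -> is_series (fun n => Im (a n)) (Im l).
Proof.
intros Ha.
apply filterlim_ext with (fun n => Im (Csum_n a n)).
{ intros n. induction n as [|n IH]; [now rewrite !sum_O|].
  rewrite !sum_Sn, <- IH. reflexivity. }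
apply filterlim_comp with (2 := continuous_snd (U := R_UniformSpace) (V := R_UniformSpace) (fst l) (snd l)).
destruct l. exact Ha.
Qed.

Lemma Cmod_sum_n_minus_le (a : nat -> C) (c : nat -> R) (m N : nat) :
  (forall n, Cmod (a n) <= c n) -> (m <= N)%nat ->
  Cmod (Csum_n a N - Csum_n a m) <= sum_n c N - sum_n c m.
Proof.
intros Hc. induction 1 as [|N _ IH].
- replace (Csum_n a m - Csum_n a m)%C with (RtoC 0) by ring. rewrite Cmod_0. lra.
- rewrite !sum_Sn.
  replace (plus (Csum_n a N) (a (S N)) - Csum_n a m)%C
    with ((Csum_n a N - Csum_n a m) + a (S N))%C.
  2:{ change (plus (Csum_n a N) (a (S N))) with (Csum_n a N + a (S N))%C. ring. }
  apply Rle_trans with (1 := Cmod_triangle _ _). specialize (Hc (S N)).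
  change (plus (sum_n c N) (c (S N))) with (sum_n c N + c (S N)). lra.
Qed.

(** The tail beyond [m] is dominated by that of the majorant: the finite estimate is applied up to
    an [N >= m] where the partial sum is within [eps] of [l]. *)
Lemma Cmod_series_minus_le (a : nat -> C) (c : nat -> R) (l : C) (s : R) (m : nat) :
  (forall n, Cmod (a n) <= c n) -> is_Cseries a l -> is_series c s ->
  Cmod (l - Csum_n a m) <= s - sum_n c m.
Proof.
intros Hc Ha Hs. apply le_epsilon. intros eps He.
destruct (is_Cseries_approx a l eps m Ha He) as (N & HmN & HN).
assert (Hsum : sum_n c N <= s).
{ rewrite <- (is_series_unique _ _ Hs). rewrite sum_n_Reals.
  assert (Hex : ex_series c) by now exists s.
  rewrite (Series_incr_n c (S N)); [|lia|easy].
  simpl Init.Nat.pred.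
  assert (0 <= Series (fun k => c (S N + k)%nat)).
  { rewrite <- (Rmult_0_l (Series (fun k => c (S N + k)%nat))), <- Series_scal_l.
    apply Series_le; [|now apply ex_series_incr_n].
    intros n. generalize (Cmod_ge_0 (a (S N + n)%nat)) (Hc (S N + n)%nat). lra. }
  lra. }
replace (l - Csum_n a m)%C
  with (- (Csum_n a N - l) + (Csum_n a N - Csum_n a m))%C by ring.
apply Rle_trans with (1 := Cmod_triangle _ _). rewrite Cmod_opp.
generalize (Cmod_sum_n_minus_le a c m N Hc HmN). lra.
Qed.

(** * Termwise integration of power series over [0, 1] *)

(** The geometric bound makes the radius of convergence at least [1/r > 1], so termwise integration
    reaches the endpoint 1. Agreement of [f] with the series is asked only on the open interval,
    which leaves the value at [t = 0] free. *)
Lemma is_RInt_power_series (p : nat -> R) (f : R -> R) (K r l : R) :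
  0 < r < 1 -> (forall n, Rabs (p n) <= K * r ^ n) ->
  (forall t, 0 < t < 1 -> is_series (fun n => p n * t ^ n) (f t)) ->
  is_series (fun n => p n / INR (n + 1)) l ->
  is_RInt f 0 1 l.
Proof.
intros Hr Hp Hf Hl.
assert (Hcv : Rbar_lt (Rabs 1) (CV_radius p)).
{ rewrite Rabs_R1. apply Rbar_lt_le_trans with (/ r).
  - simpl. rewrite <- Rinv_1. apply Rinv_lt_contravar; lra.
  - apply (proj1 (CV_radius_bounded p)). exists K. intros n.
    rewrite pow_inv, Rabs_mult, Rabs_inv, (Rabs_pos_eq (r ^ n)).
    + apply Rle_div_l; [apply pow_lt; lra|apply Hp].
    + apply pow_le; lra. }
assert (Hval : PSeries (PS_Int p) 1 = l).
(* The integrated series has constant term 0, hence the index shift. *)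
{ apply is_series_unique. apply is_series_decr_1. simpl.
  rewrite Rmult_0_l. unfold plus, opp; simpl. rewrite Ropp_0, Rplus_0_r.
  apply is_series_ext with (2 := Hl). intros n.
  rewrite pow1, Rmult_1_r, Rmult_1_r. now rewrite Nat.add_1_r. }
rewrite <- Hval.
apply is_RInt_ext with (PSeries p); [|now apply is_RInt_PSeries].
intros t Ht. rewrite Rmin_left, Rmax_right in Ht by lra.
apply is_series_unique, Hf, Ht.
Qed.

Lemma RInt_C_power_series (p : nat -> C) (f : R -> C) (K r : R) (l : C) :
  0 < r < 1 -> (forall n, Cmod (p n) <= K * r ^ n) ->
  (forall t, 0 < t < 1 -> is_Cseries (fun n => p n * RtoC (t ^ n))%C (f t)) ->
  is_Cseries (fun n => p n / RtoC (INR (n + 1)))%C l ->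
  @RInt C_R_CompleteNormedModule f 0 1 = l.
Proof.
intros Hr Hp Hf Hl. apply (is_RInt_unique (V := C_R_CompleteNormedModule)).
destruct l as [l1 l2].
assert (HINR : forall n, INR (n + 1) <> 0) by (intros n; apply not_0_INR; lia).
apply (is_RInt_fct_extend_pair (U := R_NormedModule) (V := R_NormedModule)).
- apply (is_RInt_power_series (fun n => Re (p n)) _ K r); [easy| | |].
  + intros n. now apply Rle_trans with (1 := re_le_Cmod _).
  + intros t Ht. apply is_series_ext with (2 := is_series_Re _ _ (Hf t Ht)).
    intros n. unfold Re. simpl. ring.
  + apply is_series_ext with (2 := is_series_Re _ _ Hl).
    intros n. unfold Cdiv. rewrite <- RtoC_inv by easy.
    unfold Re, Rdiv. simpl. ring.
- apply (is_RInt_power_series (fun n => Im (p n)) _ K r); [easy| | |].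
  + intros n. apply Rle_trans with (2 := Hp n).
    apply Rle_trans with (2 := Rmax_Cmod _). apply Rmax_r.
  + intros t Ht. apply is_series_ext with (2 := is_series_Im _ _ (Hf t Ht)).
    intros n. unfold Im. simpl. ring.
  + apply is_series_ext with (2 := is_series_Im _ _ Hl).
    intros n. unfold Cdiv. rewrite <- RtoC_inv by easy.
    unfold Im, Rdiv. simpl. ring.
Qed.

(** * The Alexander transform and its partial sums *)

Lemma is_Cseries_scal (c : C) (a : nat -> C) (l : C) :
  is_Cseries a l -> is_Cseries (fun n => c * a n)%C (c * l)%C.
Proof. exact (is_series_scal (K := C_AbsRing) (V := C_NormedModule) c a l). Qed.

(** This is the source of the factor 1/2 in the geometric ratio: [(n + 1)!] has [n] factors that are
    at least 2. *)
Lemma pow2_le_fact_S (n : nat) : 2 ^ n <= INR (fact (n + 1)).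
Proof.
induction n as [|n IH]; [simpl; lra|].
replace (S n + 1)%nat with (S (n + 1)) by lia.
rewrite fact_simpl, mult_INR. simpl pow.
apply Rmult_le_compat; [lra|apply pow_le; lra| |easy].
rewrite S_INR, plus_INR. generalize (pos_INR n). simpl. lra.
Qed.

(** Index 0 accounts for the leading term [z], so that the transform is [z] times a single power
    series. *)
Definition alexander_coef (alpha gamma : R) (beta : C) (n : nat) : C :=
  (rabotnov_coef alpha gamma beta n / RtoC (INR (n + 1)))%C.

Lemma Cmod_alexander_coef_le (alpha gamma : R) (beta : C) (n : nat) :
  1 <= gamma + alpha ->
  Cmod (alexander_coef alpha gamma beta n)
    <= (Cmod beta / (gamma + alpha) / 2) ^ n.
Proof.
intros Hs. unfold alexander_coef.
assert (Hn : 0 < INR (n + 1)) by (apply lt_0_INR; lia).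
rewrite Cmod_div, Cmod_R, Rabs_pos_eq.
2: lra.
2:{ intros H. apply RtoC_inj in H. lra. }
set (x := Cmod beta / (gamma + alpha)).
assert (Hx : 0 <= x) by (apply Rdiv_le_0_compat; [apply Cmod_ge_0|lra]).
assert (Hf : 0 < INR (fact n)) by apply INR_fact_lt_0.
apply Rle_trans with (x ^ n / INR (fact n) / INR (n + 1)).
{ apply Rmult_le_compat_r; [left; now apply Rinv_0_lt_compat|].
  now apply Cmod_rabotnov_coef_le. }
replace (x ^ n / INR (fact n) / INR (n + 1)) with (x ^ n * / INR (fact (n + 1))).
2:{ rewrite Nat.add_1_r, fact_simpl, mult_INR, <- Nat.add_1_r. field. lra. }
replace ((x / 2) ^ n) with (x ^ n * / 2 ^ n)
  by (unfold Rdiv; now rewrite Rpow_mult_distr, pow_inv).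
apply Rmult_le_compat_l; [now apply pow_le|].
apply Rinv_le_contravar; [apply pow_lt; lra|apply pow2_le_fact_S].
Qed.

Lemma rabotnov_coef_0 (alpha gamma : R) (beta : C) :
  1 <= gamma + alpha -> rabotnov_coef alpha gamma beta 0 = RtoC 1.
Proof.
intros Hs. unfold rabotnov_coef.
replace ((gamma + alpha) * INR (0 + 1)) with (gamma + alpha) by (simpl; ring).
simpl. field. intros H. apply RtoC_inj in H.
generalize (proj2 (Gamma_correct _ Hs)). lra.
Qed.

Lemma ex_Cseries_geom_le (a : nat -> C) (q : R) :
  0 <= q < 1 -> (forall n, Cmod (a n) <= q ^ n) -> exists l : C, is_Cseries a l.
Proof.
intros Hq Ha.
apply (ex_series_le (K := C_AbsRing) (V := C_CompleteNormedModule) a (fun n => q ^ n) Ha).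
exists (/ (1 - q)). apply is_series_geom. rewrite Rabs_pos_eq; lra.
Qed.

Lemma Cmod_rabotnov_coef_le_1 (alpha gamma : R) (beta : C) (n : nat) :
  1 <= gamma + alpha -> Cmod beta <= gamma + alpha ->
  Cmod (rabotnov_coef alpha gamma beta n) <= 1.
Proof.
intros Hs Hb. apply Rle_trans with (1 := Cmod_rabotnov_coef_le _ _ _ n Hs).
assert (Hx : 0 <= Cmod beta / (gamma + alpha) <= 1).
{ split; [apply Rdiv_le_0_compat; [apply Cmod_ge_0|lra]|].
  apply Rle_div_l; lra. }
assert (H1 : 1 <= INR (fact n)) by (apply (le_INR 1), lt_O_fact).
apply Rle_div_l; [lra|].
rewrite Rmult_1_l. apply Rle_trans with (2 := H1).
rewrite <- (pow1 n). now apply pow_incr.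
Qed.

Lemma is_Cseries_rabotnov (alpha gamma : R) (beta w : C) :
  1 <= gamma + alpha -> Cmod beta <= gamma + alpha -> Cmod w < 1 ->
  is_Cseries (fun n => rabotnov_coef alpha gamma beta n * w ^ (n + 1))%C
    (rabotnov alpha gamma beta w).
Proof.
intros Hs Hb Hw. generalize (Cmod_ge_0 w). intros Hw0.
destruct (ex_Cseries_geom_le
  (fun n => rabotnov_coef alpha gamma beta n * w ^ (n + 1))%C (Cmod w)) as [l Hl].
- easy.
- intros n. rewrite Cmod_mult, Cmod_pow, Nat.add_1_r. simpl pow.
  generalize (Cmod_rabotnov_coef_le_1 _ _ _ n Hs Hb)
    (Cmod_ge_0 (rabotnov_coef alpha gamma beta n)) (pow_le _ n Hw0).
  intros H1 H2 H3.
  apply Rle_trans with (1 * (Cmod w * Cmod w ^ n)).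
  + apply Rmult_le_compat_r; [now apply Rmult_le_pos|easy].
  + rewrite Rmult_1_l, <- (Rmult_1_l (Cmod w ^ n)) at 1.
    apply Rle_trans with (Cmod w * Cmod w ^ n); [right; ring|].
    rewrite <- (Rmult_1_l (Cmod w ^ n)) at 2. apply Rmult_le_compat_r; lra.
- replace (rabotnov alpha gamma beta w) with l; [exact Hl|].
  unfold rabotnov.
  (* The definition adds [w] separately; it is the term of index 0 of the full series. *)
  rewrite (CSeries_unique _ (l - w)%C); [ring|].
  apply (is_series_incr_1 (K := C_AbsRing) (V := C_NormedModule)
    (fun n => rabotnov_coef alpha gamma beta n * w ^ (n + 1))%C).
  rewrite rabotnov_coef_0 by easy.
  match goal with |- is_series _ ?v => assert (Hv : v = l) end.
  { change ((l - w) + 1 * (w * 1) = l)%C. ring. }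
  rewrite Hv. exact Hl.
Qed.

(** Along [w = t z] the integrand is a power series in [t] with coefficients [A_n z^(n+1)], bounded
    by [|z| |z|^n]. Integration over [0, 1] divides the n-th one by [n + 1]. *)
Lemma alexander_rabotnov_eq (alpha gamma : R) (beta z l : C) :
  1 <= gamma + alpha -> Cmod beta <= gamma + alpha ->
  z <> RtoC 0 -> Cmod z < 1 ->
  is_Cseries (fun n => alexander_coef alpha gamma beta n * z ^ n)%C l ->
  alexander (rabotnov alpha gamma beta) z = (z * l)%C.
Proof.
intros Hs Hb Hz Hz1 Hl. unfold alexander.
assert (Hz0 : 0 < Cmod z) by now apply Cmod_gt_0.
apply (RInt_C_power_series
  (fun n => rabotnov_coef alpha gamma beta n * z ^ (n + 1))%C _ (Cmod z) (Cmod z)).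
- easy.
- intros n. rewrite Cmod_mult, Cmod_pow, Nat.add_1_r. simpl pow.
  rewrite <- (Rmult_1_l (Cmod z * Cmod z ^ n)) at 2.
  apply Rmult_le_compat_r; [|now apply Cmod_rabotnov_coef_le_1].
  apply Rmult_le_pos; [lra|apply pow_le; lra].
- intros t Ht. set (w := (RtoC t * z)%C).
  assert (Ht0 : RtoC t <> RtoC 0) by (intros H; apply RtoC_inj in H; lra).
  assert (Hw : Cmod w < 1).
  { unfold w. rewrite Cmod_mult, Cmod_R, Rabs_pos_eq by lra. nra. }
  apply (is_series_ext (K := C_AbsRing) (V := C_NormedModule)
    (fun n => (/ RtoC t) * (rabotnov_coef alpha gamma beta n * w ^ (n + 1)))%C).
  + intros n. unfold w. rewrite Cpow_mult_l, !Cpow_add_r, RtoC_pow. simpl.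
    now field.
  + replace (rabotnov alpha gamma beta w / w * z)%C
      with (/ RtoC t * rabotnov alpha gamma beta w)%C.
    * now apply is_Cseries_scal, is_Cseries_rabotnov.
    * unfold w at 3. now field.
- apply (is_series_ext (K := C_AbsRing) (V := C_NormedModule)
    (fun n => z * (alexander_coef alpha gamma beta n * z ^ n))%C).
  + intros n. unfold alexander_coef. rewrite Cpow_add_r. simpl.
    field. intros H. apply RtoC_inj in H. revert H. apply not_0_INR. lia.
  + now apply is_Cseries_scal.
Qed.

Lemma alexander_coef_0 (alpha gamma : R) (beta : C) :
  1 <= gamma + alpha -> alexander_coef alpha gamma beta 0 = RtoC 1.
Proof.
intros Hs. unfold alexander_coef. rewrite rabotnov_coef_0 by easy. simpl.
field.
Qed.

Lemma alexander_rabotnov_partial_eq (alpha gamma : R) (beta z : C) (m : nat) :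
  1 <= gamma + alpha ->
  alexander_rabotnov_partial alpha gamma beta m z
    = (z * Csum_n (fun n => alexander_coef alpha gamma beta n * z ^ n) m)%C.
Proof.
intros Hs. unfold alexander_rabotnov_partial.
induction m as [|m IH].
- rewrite sum_O, sum_n_m_zero by lia. unfold alexander_coef.
  rewrite rabotnov_coef_0 by easy.
  change (z + 0 = z * (1 / 1 * 1))%C. field.
- rewrite sum_n_Sm, sum_Sn by lia.
  match goal with |- (z + plus ?u ?v = z * plus ?u' ?v')%C =>
    change (z + (u + v) = z * (u' + v'))%C end.
  rewrite Cmult_plus_distr_l, <- IH, Cplus_assoc. f_equal.
  unfold alexander_coef. rewrite (Cpow_add_r z (S m)). simpl (z ^ 1)%C.
  unfold Cdiv. ring.
Qed.

(* [p] and [q] are the transform and its partial sum, both divided by [z]. *)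
Lemma alexander_rabotnov_factor (alpha gamma : R) (beta z : C) (m : nat) :
  1 <= gamma + alpha -> Cmod beta <= gamma + alpha ->
  z <> RtoC 0 -> Cmod z < 1 ->
  let e := Cmod beta / (gamma + alpha) / 2 * Cmod z in
  exists p q h,
    alexander (rabotnov alpha gamma beta) z = (z * p)%C /\
    alexander_rabotnov_partial alpha gamma beta m z = (z * q)%C /\
    Cmod (q - 1) <= h /\ Cmod (p - q) <= e / (1 - e) - h.
Proof.
intros Hs Hb Hz Hz1 e.
assert (Hz0 : 0 < Cmod z) by now apply Cmod_gt_0.
assert (Hx : 0 <= Cmod beta / (gamma + alpha) <= 1).
{ split; [apply Rdiv_le_0_compat; [apply Cmod_ge_0|lra]|].
  apply Rle_div_l; lra. }
assert (He : 0 <= e < 1) by (unfold e; nra).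
set (a := fun n => (alexander_coef alpha gamma beta n * z ^ n)%C).
assert (Ha : forall n, Cmod (a n) <= e ^ n).
{ intros n. unfold a, e. rewrite Cmod_mult, Cmod_pow, Rpow_mult_distr.
  apply Rmult_le_compat_r; [apply pow_le; lra|now apply Cmod_alexander_coef_le]. }
destruct (ex_Cseries_geom_le a e He Ha) as [p Hp].
(* Here [h = e + ... + e^m]; since [e / (1 - e)] sums all [e^n] with [n >= 1], the remainder bounds
   the tail [p - q]. *)
exists p, (Csum_n a m), (sum_n (fun n => e ^ n) m - 1).
split; [now apply alexander_rabotnov_eq|].
split; [now apply alexander_rabotnov_partial_eq|].
split.
- replace (RtoC 1) with (Csum_n a 0).
  2:{ rewrite sum_O. unfold a. rewrite alexander_coef_0 by easy. simpl. ring. }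
  replace 1 with (sum_n (fun n => e ^ n) 0) by now rewrite sum_O.
  apply Cmod_sum_n_minus_le; [easy|lia].
- replace (e / (1 - e) - (sum_n (fun n => e ^ n) m - 1))
    with (/ (1 - e) - sum_n (fun n => e ^ n) m) by (field; lra).
  apply Cmod_series_minus_le; [easy|easy|].
  apply is_series_geom. rewrite Rabs_pos_eq; lra.
Qed.

(** * Quotients close to 1 and their real parts *)

Lemma Cmod_one_sub_le (q : C) : 1 - Cmod (q - 1) <= Cmod q.
Proof.
generalize (Cmod_triangle (q) (- (q - 1))). rewrite Cmod_opp.
replace (q + - (q - 1))%C with (RtoC 1) by ring. rewrite Cmod_1. lra.
Qed.

Lemma Cmod_lt_1_neq_0 (q : C) : Cmod (q - 1) < 1 -> q <> RtoC 0.
Proof.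
intros H. apply Cmod_gt_0. generalize (Cmod_one_sub_le q). lra.
Qed.

(** Nonnegativity of the moduli forces [0 <= h <= r < 1], so [|q| >= 1 - h > 0], and
    [r - h <= r (1 - h)]. *)
Lemma Cmod_quotient_minus_one_le (p q : C) (h r : R) :
  Cmod (q - 1) <= h -> Cmod (p - q) <= r - h -> r < 1 ->
  Cmod (p / q - 1) <= r.
Proof.
intros Hq Hp Hr.
generalize (Cmod_ge_0 (p - q)) (Cmod_ge_0 (q - 1)) (Cmod_one_sub_le q). intros H1 H2 H3.
assert (Hq0 : q <> RtoC 0) by (apply Cmod_lt_1_neq_0; lra).
replace (p / q - 1)%C with ((p - q) / q)%C by now field.
rewrite Cmod_div by easy. apply Rle_div_l; [lra|]. nra.
Qed.

Lemma Re_ge_one_sub (u : C) (r : R) : Cmod (u - 1) <= r -> 1 - r <= Re u.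
Proof.
intros Hu. generalize (re_le_Cmod (u - 1)).
replace (Re (u - 1)) with (Re u - 1) by (unfold Re; simpl; ring).
intros H.
generalize (Rle_abs (- (Re u - 1))). rewrite Rabs_Ropp. lra.
Qed.

(* [1 / u] ranges over the disc with diameter from [1 / (1 + r)] to [1 / (1 - r)]. *)
Lemma Re_inv_ge (u : C) (r : R) :
  Cmod (u - 1) <= r -> r < 1 -> / (1 + r) <= Re (/ u).
Proof.
intros Hu Hr.
generalize (Cmod_ge_0 (u - 1)). intros H0.
generalize (Re_ge_one_sub u r Hu). intros Hre.
assert (Hsq : (Re u - 1) ^ 2 + Im u ^ 2 <= r ^ 2).
{ replace ((Re u - 1) ^ 2 + Im u ^ 2) with (Cmod (u - 1) ^ 2).
  - apply pow_incr. lra.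
  - rewrite Cmod2_alt. unfold Re, Im. simpl. ring. }
replace (Re (/ u)) with (Re u / (Re u ^ 2 + Im u ^ 2)) by reflexivity.
assert (Hpos : 0 < Re u ^ 2 + Im u ^ 2)
  by (assert (0 < Re u) by lra; nra).
(* The disc gives [|u|^2 <= 2 Re u - (1 - r^2)], and the right side is at most [(1 + r) Re u]
   because [Re u <= 1 + r]. *)
assert (Hup : Re u <= 1 + r) by (apply Rnot_lt_le; intros H; nra).
apply Rle_div_r; [easy|]. rewrite Rmult_comm. apply Rle_div_l; [lra|]. nra.
Qed.

(** * The removable singularity at the origin *)

(** A bound linear in [|z|] yields the limit 1; the constant 2 and the radius 1/2 are chosen to suit
    both quotients of the theorem. *)
Lemma filterlim_quotient_one (f g : C -> C) :
  (forall z, z <> RtoC 0 -> Cmod z < / 2 ->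
    g z <> RtoC 0 /\ Cmod (f z / g z - 1) <= 2 * Cmod z) ->
  is_quotient f g (RtoC 0) (RtoC 1).
Proof.
intros H. right. split; [reflexivity|].
assert (Hball : forall eps : posreal,
  @locally' C_UniformSpace (RtoC 0) (fun z => z <> RtoC 0 /\ Cmod z < eps)).
{ intros eps.
  apply (locally_le_locally_norm (K := C_AbsRing) (V := C_NormedModule)).
  exists eps. intros z Hz Hz0. split; [exact Hz0|].
  replace z with (z - 0)%C by ring. exact Hz. }
assert (Hhalf : 0 < / 2) by lra.
split.
- generalize (Hball (mkposreal _ Hhalf)).
  apply filter_imp. intros z [Hz0 Hz]. now apply H.
- apply (filterlim_locally_ball_norm (K := C_AbsRing) (U := C_NormedModule)
    (F := @locally' C_UniformSpace (RtoC 0))).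
  intros [eps Heps].
  assert (Hmin : 0 < Rmin (/ 2) (eps / 2)) by (apply Rmin_glb_lt; lra).
  generalize (Hball (mkposreal _ Hmin)).
  apply filter_imp. intros z [Hz0 Hz]. simpl in Hz.
  destruct (H z Hz0) as [_ Hq].
  { apply Rlt_le_trans with (1 := Hz), Rmin_l. }
  apply Rle_lt_trans with (1 := Hq). simpl.
  generalize (Rlt_le_trans _ _ _ Hz (Rmin_r _ _)). lra.
Qed.

Lemma exists_quotient_Re_ge (f g : C -> C) (z : C) (c : R) :
  (forall w, w <> RtoC 0 -> Cmod w < / 2 ->
    g w <> RtoC 0 /\ Cmod (f w / g w - 1) <= 2 * Cmod w) ->
  (z <> RtoC 0 -> g z <> RtoC 0 /\ c <= Re (f z / g z)) ->
  c <= 1 ->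
  exists q, is_quotient f g z q /\ Re q >= c.
Proof.
intros H0 Hz Hc. destruct (Ceq_dec z (RtoC 0)) as [->|Hn].
- exists (RtoC 1). split; [now apply filterlim_quotient_one|].
  apply Rle_ge. exact Hc.
- destruct (Hz Hn) as [Hg HRe]. exists (f z / g z)%C.
  split; [now left|]. now apply Rle_ge.
Qed.

(** * Bounds for the two quotients *)

(** The bound [r] on [f / g] carries both inequalities. The cruder bound [2 r] on [g / f] serves to
    find the limit of that quotient at 0. *)
Lemma alexander_rabotnov_quotient (alpha gamma : R) (beta z : C) (m : nat) :
  1 <= gamma + alpha -> Cmod beta <= gamma + alpha ->
  z <> RtoC 0 -> Cmod z < 1 ->
  let f := alexander (rabotnov alpha gamma beta) z in
  let g := alexander_rabotnov_partial alpha gamma beta m z in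
  let e := Cmod beta / (gamma + alpha) / 2 * Cmod z in
  let r := e / (1 - e) in
  f <> RtoC 0 /\ g <> RtoC 0 /\ Cmod (f / g - 1) <= r
  /\ (2 * r < 1 -> Cmod (g / f - 1) <= 2 * r).
Proof.
intros Hs Hb Hz Hz1 f g e r.
destruct (alexander_rabotnov_factor _ _ _ _ m Hs Hb Hz Hz1) as (p & q & h & Hf & Hg & Hq & Hp).
fold f in Hf. fold g in Hg. fold e in Hp. fold r in Hp.
assert (Hr : r < 1).
{ assert (Hx : Cmod beta / (gamma + alpha) <= 1) by (apply Rle_div_l; lra).
  generalize (Cmod_ge_0 z). intros Hz0.
  assert (He : e < / 2) by (unfold e; nra).
  unfold r. apply Rlt_div_l; lra. }
generalize (Cmod_ge_0 (p - q)) (Cmod_ge_0 (q - 1)). intros H1 H2.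
assert (Hp1 : Cmod (p - 1) <= r).
{ replace (p - 1)%C with ((p - q) + (q - 1))%C by ring.
  apply Rle_trans with (1 := Cmod_triangle _ _). lra. }
assert (Hp0 : p <> RtoC 0) by (apply Cmod_lt_1_neq_0; lra).
assert (Hq0 : q <> RtoC 0) by (apply Cmod_lt_1_neq_0; lra).
rewrite Hf, Hg.
replace (z * p / (z * q))%C with (p / q)%C by now field.
replace (z * q / (z * p))%C with (q / p)%C by now field.
split; [now apply Cmult_neq_0|]. split; [now apply Cmult_neq_0|].
split.
- now apply Cmod_quotient_minus_one_le with h.
(* The roles of [p] and [q] are exchanged: [|p - 1| <= r] and [|q - p| <= r = 2 r - r]. *)
- intros H2r. apply Cmod_quotient_minus_one_le with r; [easy| |easy].
  replace (q - p)%C with (- (p - q))%C by ring. rewrite Cmod_opp. lra.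
Qed.

Theorem theorem1p6 :
  forall (alpha gamma : R) (beta : C),
    0 <= alpha -> 1 <= gamma -> Cmod beta <= gamma + alpha ->
    forall (m : nat) (z : C), Cmod z < 1 ->
      (exists q : C,
         is_quotient (alexander (rabotnov alpha gamma beta))
           (alexander_rabotnov_partial alpha gamma beta m) z q
         /\ Re q >= (2 * (gamma + alpha) - 2 * Cmod beta)
                    / (2 * (gamma + alpha) - Cmod beta))
      /\
      (exists q : C,
         is_quotient (alexander_rabotnov_partial alpha gamma beta m)
           (alexander (rabotnov alpha gamma beta)) z q
         /\ Re q >= (2 * (gamma + alpha) - Cmod beta)
                    / (2 * (gamma + alpha))).
Proof.
intros alpha gamma beta Halpha Hgamma Hb m z Hz.
assert (Hs : 1 <= gamma + alpha) by lra.
generalize (fun w => alexander_rabotnov_quotient alpha gamma beta w m Hs Hb).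
cbv zeta.
set (f := alexander (rabotnov alpha gamma beta)).
set (g := alexander_rabotnov_partial alpha gamma beta m).
intros Hquot.
generalize (Cmod_ge_0 beta). set (b := Cmod beta) in *. set (s := gamma + alpha) in *.
intros Hb0.
assert (Hx : 0 <= b / s <= 1).
{ split; [apply Rdiv_le_0_compat|apply Rle_div_l]; lra. }
(* For the limit at 0: [e <= |w| / 2] and [|w| < 1/2] give [r <= |w|], hence [2 r < 1]. *)
assert (Hnear : forall w, w <> RtoC 0 -> Cmod w < / 2 ->
  (g w <> RtoC 0 /\ Cmod (f w / g w - 1) <= 2 * Cmod w)
  /\ (f w <> RtoC 0 /\ Cmod (g w / f w - 1) <= 2 * Cmod w)).
{ intros w Hw0 Hw. generalize (Cmod_ge_0 w). intros Hw1.
  destruct (Hquot w Hw0) as (H1 & H2 & H3 & H4); [lra|].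
  set (e := b / s / 2 * Cmod w) in *.
  assert (He : 0 <= e <= Cmod w / 2) by (unfold e; split; nra).
  assert (Hr : e / (1 - e) <= Cmod w) by (apply Rle_div_l; nra).
  split; (split; [easy|]).
  - lra.
  - apply Rle_trans with (1 := H4 ltac:(lra)). lra. }
assert (Hfar : z <> RtoC 0 -> f z <> RtoC 0 /\ g z <> RtoC 0
  /\ exists r, 0 <= r /\ r < 1 /\ r <= b / (2 * s - b) /\ Cmod (f z / g z - 1) <= r).
{ intros Hz0. generalize (Cmod_ge_0 z). intros Hz1.
  destruct (Hquot z Hz0 Hz) as (H1 & H2 & H3 & _).
  set (e := b / s / 2 * Cmod z) in *.
  assert (He : 0 <= e /\ e < / 2 /\ e <= b / s / 2) by (unfold e; repeat split; nra).
  assert (Hr : e / (1 - e) <= b / (2 * s - b)).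
  (* The target is the value of the increasing function [t / (1 - t)] at [b / (2 s)], which is at
     least [e]. *)
  { replace (b / (2 * s - b)) with ((b / s / 2) / (1 - b / s / 2)) by (field; lra).
    set (y := b / s / 2) in *. apply Rle_div_l; [lra|].
    replace (y / (1 - y) * (1 - e)) with (y * (1 - e) / (1 - y)) by (unfold Rdiv; ring).
    assert (Hy : 0 < 1 - y) by (unfold y; lra).
    apply -> Rle_div_r; lra. }
  split; [easy|]. split; [easy|].
  exists (e / (1 - e)). repeat split; try easy.
  - apply Rdiv_le_0_compat; lra.
  - apply Rlt_div_l; lra. }
split.
- apply exists_quotient_Re_ge.
  + intros w Hw0 Hw. now apply Hnear.
  + intros Hz0. destruct (Hfar Hz0) as (_ & Hg & r & _ & _ & Hrb & Hfg).
    split; [easy|]. apply Rle_trans with (2 := Re_ge_one_sub _ _ Hfg).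
    replace ((2 * s - 2 * b) / (2 * s - b)) with (1 - b / (2 * s - b)) by (field; lra).
    lra.
  + apply Rle_div_l; lra.
- apply exists_quotient_Re_ge.
  + intros w Hw0 Hw. now apply Hnear.
  + intros Hz0. destruct (Hfar Hz0) as (Hf & Hg & r & Hr0 & Hr1 & Hrb & Hfg).
    split; [easy|].
    (* Inverting the first quotient keeps the sharp [r]; with the bound [2 r] on [g / f] only
       [1 - 2 r] would result. *)
    replace (g z / f z)%C with (/ (f z / g z))%C by now field.
    apply Rle_trans with (2 := Re_inv_ge _ _ Hfg Hr1).
    replace ((2 * s - b) / (2 * s)) with (/ (1 + b / (2 * s - b))) by (field; lra).
    apply Rinv_le_contravar; lra.
  + apply Rle_div_l; lra.
Qed.
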